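(* Let $A:\mathcal{H}\to\mathcal{H}$ be an accretive bounded linear operator on a (real or complex) Hilbert space $\mathcal{H}$ with $\mathcal{R}(A)\neq\mathcal{H}$. Then any parameter choice strategy for Lavrentiev regularization is weakly quasi-optimal if and only if it is strongly quasi-optimal.
   Context: A bounded linear operator $A:\mathcal{H}\to\mathcal{H}$ on a real or complex Hilbert space is called accretive if $\mathrm{Re}\,\langle Au,u\rangle\ge 0$ for all $u\in\mathcal{H}$; then for every $\gamma>0$ the operator $A+\gamma I$ has a bounded inverse with $\|(A+\gamma I)^{-1}\|\le 1/\gamma$. $\mathcal{R}(A)$ denotes the range of $A$. For $\gamma>0$ and $f^\delta\in\mathcal{H}$ put $u^\delta_\gamma:=(A+\gamma I)^{-1}f^\delta$, and $u^\delta_\infty:=0$. For $u\in\mathcal{H}$ put $u_\gamma:=(A+\gamma I)^{-1}Au$. For $u\in\mathcal{H}$, $\delta>0$ define $$P^\delta(u):=\sup_{f^\delta\in\mathcal{H}:\ \|Au-f^\delta\|\le\delta}\ \inf_{\gamma>0}\|u^\delta_\gamma-u\|,\qquad R^\delta_1(u):=\inf_{\gamma>0}\Big\{\|u_\gamma-u\|+\tfrac{\delta}{\gamma}\Big\}.$$ A parameter choice strategy is a map assigning to each $\delta>0$ and $f^\delta\in\mathcal{H}$ a parameter $\gamma(\delta,f^\delta)$ with $0<\gamma(\delta,f^\delta)\le\infty$. It is called strongly quasi-optimal if there is a constant $c>0$ such that for each $u\in\mathcal{H}$, $\delta>0$ and $f^\delta\in\mathcal{H}$ with $\|Au-f^\delta\|\le\delta$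 we have $\|u^\delta_{\gamma(\delta,f^\delta)}-u\|\le cP^\delta(u)$. It is called weakly quasi-optimal if there is a constant $c>0$ such that for each $u\in\mathcal{H}$, $\delta>0$ and $f^\delta\in\mathcal{H}$ with $\|Au-f^\delta\|\le\delta$ we have $\|u^\delta_{\gamma(\delta,f^\delta)}-u\|\le cR^\delta_1(u)$. *)

(* Defs.v *)
From HB Require Import structures.
From mathcomp Require Import all_boot all_order all_algebra.
From mathcomp Require Import complex.
From mathcomp Require Import all_classical all_reals all_analysis.

Set Implicit Arguments.
Unset Strict Implicit.
Unset Printing Implicit Defensive.

Import Order.TTheory GRing.Theory Num.Theory.
Import numFieldNormedType.Exports.

Local Open Scope classical_set_scope.
Local Open Scope ring_scope.

Variant scalar_kind := RealScalars | ComplexScalars.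

Definition scalars (R : realType) (k : scalar_kind) : numFieldType :=
  match k with
  | RealScalars => R
  | ComplexScalars => R[i]
  end.

Definition scalar_conj (R : realType) (k : scalar_kind) :
    scalars R k -> scalars R k :=
  match k with
  | RealScalars => idfun
  | ComplexScalars => @Num.conj R[i]
  end.

Definition scalar_re (R : realType) (k : scalar_kind) : scalars R k -> R :=
  match k with
  | RealScalars => idfun
  | ComplexScalars => @complex.Re R
  end.

Definition scalar_of_real (R : realType) (k : scalar_kind) :
    R -> scalars R k :=
  match k with
  | RealScalars => idfun
  | ComplexScalars => fun x => (x%:C)%C
  end.

(* The form of type {dot _ for _} is linear in its first argument and
   conjugate-linear in its second one. *)
Record hilbertSpace (R : realType) (k : scalar_kind) := HilbertSpace {
  hilbert_sort :> completeNormedModType (scalars R k);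
  inner : {dot hilbert_sort for @scalar_conj R k};
  inner_norm : forall u : hilbert_sort, inner u u = `|u| ^+ 2
}.

Arguments inner {R k} h.

Section Lavrentiev.
Variables (R : realType) (k : scalar_kind) (H : hilbertSpace R k).
Implicit Types (A : {linear H -> H}) (u f : H) (delta gamma c : R).

(* The norm of a complex normed module takes its (real) values in R[i]. *)
Definition hnorm u : R := scalar_re `|u|.

Definition accretive A : Prop := forall u, 0 <= scalar_re (inner H (A u) u).

(* The partial inverse 'pinv_ is a two-sided inverse as soon as A + gamma I is
   bijective, which holds for gamma > 0 when A is bounded and accretive. *)
Definition resolvent A gamma : H -> H :=
  'pinv_(fun=> 0) setT (fun v : H => A v + scalar_of_real k gamma *: v).

Definition noisy_approx A f (gamma : \bar R) : H :=
  if gamma is r%:E then resolvent A r f else 0.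

Definition exact_approx A u gamma : H := resolvent A gamma (A u).

Definition best_error A delta u : \bar R :=
  ereal_sup [set ereal_inf [set (hnorm (noisy_approx A f gamma%:E - u))%:E
                           | gamma in [set gamma : R | 0 < gamma]]
            | f in [set f : H | hnorm (A u - f) <= delta]].

Definition best_bound A delta u : \bar R :=
  ereal_inf [set (hnorm (exact_approx A u gamma - u) + delta / gamma)%:E
            | gamma in [set gamma : R | 0 < gamma]].

Definition parameter_choice (gam : R -> H -> \bar R) : Prop :=
  forall delta f, 0 < delta -> (0 < gam delta f)%E.

Definition strongly_quasi_optimal A (gam : R -> H -> \bar R) : Prop :=
  exists c, 0 < c /\
    forall u delta f, 0 < delta -> hnorm (A u - f) <= delta ->
      ((hnorm (noisy_approx A f (gam delta f) - u))%:E
         <= c%:E * best_error A delta u)%E.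

Definition weakly_quasi_optimal A (gam : R -> H -> \bar R) : Prop :=
  exists c, 0 < c /\
    forall u delta f, 0 < delta -> hnorm (A u - f) <= delta ->
      ((hnorm (noisy_approx A f (gam delta f) - u))%:E
         <= c%:E * best_bound A delta u)%E.

End Lavrentiev.

(* Main.v *)
Require Import Defs.
From HB Require Import structures.
From mathcomp Require Import all_boot all_order all_algebra.
From mathcomp Require Import complex.
From mathcomp Require Import all_classical all_reals all_analysis.
From mathcomp Require Import ring lra.

(** Write P and R1 for best_error and best_bound.  P <= R1 is the triangle
    inequality together with |(A + g)^-1| <= 1 / g, so the point is R1 <= 5 P.
    Since A is accretive and not onto, it is not bounded below, hence for every
    eta > 0 there is a unit vector v with Re <A w, v> <= eta |w| for all w.
    Choose the sign of v so that Re <u, v> <= 0 and take f = A u + delta v.  The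
    error z = (A + g)^-1 f - u satisfies A z + g z = delta v - g u; pairing with
    v gives delta <= (g + eta) |z| for all g > 0 at once.  If g >= eta this
    bounds delta / g, hence R1, by a multiple of |z|; if g < eta, a small enough
    eta makes |z| exceed |u| + delta >= R1. *)

Set Implicit Arguments.
Unset Strict Implicit.
Unset Printing Implicit Defensive.

Import Order.TTheory GRing.Theory Num.Theory.
Import numFieldNormedType.Exports.

Local Open Scope classical_set_scope.
Local Open Scope ring_scope.

(** * Real numbers inside the real or complex scalars *)

Section Scalars.
Variables (R : realType) (k : scalar_kind).
Implicit Types (r s : R) (z : scalars R k).

Lemma scalar_of_realD r s :
  scalar_of_real k (r + s) = scalar_of_real k r + scalar_of_real k s.
Proof. by case: k => //=; rewrite rmorphD. Qed.

Lemma scalar_of_realM r s :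
  scalar_of_real k (r * s) = scalar_of_real k r * scalar_of_real k s.
Proof. by case: k => //=; rewrite rmorphM. Qed.

Lemma scalar_of_realN r : scalar_of_real k (- r) = - scalar_of_real k r.
Proof. by case: k => //=; rewrite rmorphN. Qed.

Lemma scalar_of_real0 : scalar_of_real k 0 = 0 :> scalars R k.
Proof. by case: k. Qed.

Lemma scalar_of_real1 : scalar_of_real k 1 = 1 :> scalars R k.
Proof. by case: k. Qed.

Lemma scalar_of_realK : cancel (@scalar_of_real R k) (@scalar_re R k).
Proof. by case: k. Qed.

Lemma ler_scalar_of_real r s :
  (scalar_of_real k r <= scalar_of_real k s) = (r <= s).
Proof. by case: k => //=; rewrite lecR. Qed.

Lemma ltr_scalar_of_real r s :
  (scalar_of_real k r < scalar_of_real k s) = (r < s).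
Proof. by case: k => //=; rewrite ltcR. Qed.

Lemma normr_scalar_of_real r : `|scalar_of_real k r| = scalar_of_real k `|r|.
Proof. by case: k => //=; rewrite normc_def /= expr0n addr0 sqrtr_sqr. Qed.

(** Comparable elements of [R[i]] have equal imaginary parts, so a nonnegative scalar is real. *)
Lemma scalar_reK z : 0 <= z -> scalar_of_real k (scalar_re z) = z.
Proof. by case: k z => //= z z0; rewrite RRe_real// ger0_real. Qed.

Lemma scalar_reD z z' : scalar_re (z + z') = scalar_re z + scalar_re z'.
Proof. by case: k z z' => //= -[a b] [c d]. Qed.

Lemma scalar_re_conj z : scalar_re (scalar_conj z) = scalar_re z.
Proof. by case: k z => //= -[a b]. Qed.

Lemma scalar_re_realM r z :
  scalar_re (scalar_of_real k r * z) = r * scalar_re z.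
Proof. by case: k z => //= -[a b] /=; rewrite mul0r subr0. Qed.

End Scalars.

(** * The real inner product underlying H *)

Section Hilbert.
Variables (R : realType) (k : scalar_kind) (H : hilbertSpace R k).
Implicit Types (u v w x y : H) (r s : R).
Local Notation "r %:K" := (scalar_of_real k r)
  (at level 1, format "r %:K").

(** This makes H a real inner product space with the same norm, so that the real and complex cases
    are treated together from here on. *)
Definition re_inner u v : R := scalar_re (inner H u v).

Lemma re_innerC u v : re_inner u v = re_inner v u.
Proof.
rewrite /re_inner.
have -> : inner H u v = scalar_conj (inner H v u).
  have := @hermitian_subproof _ _ _ _ (inner H) u v.
  by rewrite expr0 mul1r.
exact: scalar_re_conj.
Qed.

Lemma re_innerDl u v w : re_inner (u + v) w = re_inner u w + re_inner v w.
Proof. by rewrite /re_inner linearDl scalar_reD. Qed.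

Lemma re_innerZl r u v : re_inner (r%:K *: u) v = r * re_inner u v.
Proof. by rewrite /re_inner linearZl_LR scalar_re_realM. Qed.

Lemma re_innerDr u v w : re_inner u (v + w) = re_inner u v + re_inner u w.
Proof. by rewrite re_innerC re_innerDl !(re_innerC u). Qed.

Lemma re_innerZr r u v : re_inner u (r%:K *: v) = r * re_inner u v.
Proof. by rewrite re_innerC re_innerZl re_innerC. Qed.

Lemma scaleN1K u : (-1)%:K *: u = - u.
Proof. by rewrite scalar_of_realN scalar_of_real1 scaleN1r. Qed.

Lemma re_innerNl u v : re_inner (- u) v = - re_inner u v.
Proof. by rewrite -scaleN1K re_innerZl mulN1r. Qed.

Lemma re_innerNr u v : re_inner u (- v) = - re_inner u v.
Proof. by rewrite re_innerC re_innerNl re_innerC. Qed.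

Lemma normr_hnorm u : `|u| = (hnorm u)%:K.
Proof. by rewrite /hnorm scalar_reK. Qed.

Lemma hnorm_ge0 u : 0 <= hnorm u.
Proof. by rewrite -(ler_scalar_of_real k) -normr_hnorm scalar_of_real0. Qed.

Lemma re_inner_hnorm u : re_inner u u = hnorm u ^+ 2.
Proof.
by rewrite /re_inner inner_norm normr_hnorm expr2 -scalar_of_realM
  scalar_of_realK -expr2.
Qed.

Lemma ler_hnormD u v : hnorm (u + v) <= hnorm u + hnorm v.
Proof.
by rewrite -(ler_scalar_of_real k) scalar_of_realD -!normr_hnorm ler_normD.
Qed.

Lemma hnormZ r u : hnorm (r%:K *: u) = `|r| * hnorm u.
Proof.
by rewrite {1}/hnorm normrZ normr_scalar_of_real scalar_re_realM.
Qed.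

Lemma hnormN u : hnorm (- u) = hnorm u.
Proof. by rewrite /hnorm normrN. Qed.

Lemma hnorm_eq0 u : hnorm u = 0 -> u = 0.
Proof.
by move=> u0; apply/eqP; rewrite -normr_eq0 normr_hnorm u0 scalar_of_real0.
Qed.
End Hilbert.

(** * Cauchy-Schwarz and closed ranges *)

Lemma discriminant_le (R : realFieldType) (a b c : R) :
  0 <= c -> (forall t, 0 <= a + t * (b *+ 2) + t ^+ 2 * c) -> b ^+ 2 <= a * c.
Proof.
move=> c0 abc; have [c_eq0|c_neq0] := eqVneq c 0.
  have [->|b0] := eqVneq b 0; first by rewrite c_eq0 expr0n mulr0.
  (* For c = 0 the polynomial is affine, and at this t it takes the value -1. *)
  have := abc (- (a + 1) / (b *+ 2)).
  by rewrite c_eq0 mulr0 addr0 mulfVK ?mulrn_eq0//; lra.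
(* The minimizer of the quadratic. *)
have := abc (- b / c).
have -> : a + - b / c * (b *+ 2) + (- b / c) ^+ 2 * c = a - b ^+ 2 / c by field.
by rewrite subr_ge0 ler_pdivrMr// lt_neqAle eq_sym c_neq0.
Qed.

Section HilbertGeometry.
Variables (R : realType) (k : scalar_kind) (H : hilbertSpace R k).
Implicit Types (u v w x y f : H) (r s c d : R).
Local Notation "r %:K" := (scalar_of_real k r)
  (at level 1, format "r %:K").

(** Definiteness is not assumed: besides [re_inner], this serves for the symmetrized form of A,
    which may be degenerate. *)
Lemma psd_CauchySchwarz (B : H -> H -> R) :
  (forall x y, B x y = B y x) ->
  (forall x y z, B (x + y) z = B x z + B y z) ->
  (forall r x y, B (r%:K *: x) y = r * B x y) ->
  (forall x, 0 <= B x x) ->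
  forall x y, B x y ^+ 2 <= B x x * B y y.
Proof.
move=> BC BD BZ B0 x y; apply: discriminant_le => // t.
have := B0 (x + t%:K *: y).
rewrite BD BZ (BC x) (BC y) !BD !BZ (BC y x).
by congr (_ <= _); ring.
Qed.

Lemma re_inner_le u v : re_inner u v <= hnorm u * hnorm v.
Proof.
have uv0 : 0 <= hnorm u * hnorm v by rewrite mulr_ge0 ?hnorm_ge0.
have [/ltW uv|uv] := ltP (re_inner u v) 0; first exact: le_trans uv uv0.
rewrite -ler_sqr ?nnegrE// exprMn -!re_inner_hnorm.
apply: psd_CauchySchwarz.
- exact: re_innerC.
- exact: re_innerDl.
- exact: re_innerZl.
- by move=> x; rewrite re_inner_hnorm sqr_ge0.
Qed.

Lemma hnorm_subC u v : hnorm (u - v) = hnorm (v - u).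
Proof. by rewrite -hnormN opprB. Qed.

Lemma hnorm_subZ_sqr r u v :
  hnorm (u - r%:K *: v) ^+ 2 =
  hnorm u ^+ 2 - r * re_inner v u *+ 2 + r ^+ 2 * hnorm v ^+ 2.
Proof.
rewrite -!re_inner_hnorm !re_innerDl !re_innerDr !re_innerNl !re_innerNr.
by rewrite !re_innerZl !re_innerZr (re_innerC u v); ring.
Qed.

(** The lower bound makes a sequence of approximate solutions Cauchy, and the upper bound carries
    the vanishing residual over to its limit. *)
Lemma bilipschitz_closed_range (T : H -> H) c d f :
  0 < c -> 0 <= d ->
  (forall x y, c * hnorm (x - y) <= hnorm (T x - T y)) ->
  (forall x y, hnorm (T x - T y) <= d * hnorm (x - y)) ->
  (forall e : R, 0 < e -> exists x, hnorm (T x - f) <= e) ->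
  exists x, T x = f.
Proof.
move=> c0 d0 lowT upT denseT.
have /choice[x_ Tx_] : forall n : nat, exists x, hnorm (T x - f) <= n.+1%:R^-1.
  by move=> n; apply: denseT; rewrite invr_gt0.
have /cvg_ex[x x_x] : cvg (x_ @ \oo).
  apply: cauchy_cvg; apply: cauchy_exP => e e0.
  have e'0 : 0 < scalar_re e.
    by rewrite -(ltr_scalar_of_real k) scalar_of_real0 scalar_reK ?ltW.
  (* Two residuals below this add up to less than c e, and the lower bound divides by c. *)
  have ce0 : 0 < c * scalar_re e / 2 by rewrite divr_gt0 ?mulr_gt0.
  have [N _ xN] := near_infty_natSinv_lt (PosNum ce0).
  exists (x_ N); exists N => //= n /= Nn.
  rewrite -ball_normE /= normr_hnorm -(scalar_reK (ltW e0)) ltr_scalar_of_real.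
  rewrite -(ltr_pM2l c0); apply: le_lt_trans (lowT _ _) _.
  rewrite -(subrKA f); apply: le_lt_trans (ler_hnormD _ _) _.
  have := xN _ (leqnn N); have := xN _ Nn; rewrite /= => Hn HN.
  have := Tx_ N; have := Tx_ n; rewrite (hnorm_subC f) => Gn GN.
  by rewrite [ltRHS]splitr ltrD// ?(le_lt_trans GN)// (le_lt_trans Gn).
exists x; apply/eqP; rewrite -subr_eq0; apply/eqP/hnorm_eq0/le_anti.
rewrite hnorm_ge0 andbT; apply/ler_addgt0Pl => e e0; rewrite addr0.
(* The divisor is d + 1 because d may be 0. *)
have e'0 : 0 < e / 2 / (d + 1) by rewrite !divr_gt0// ltr_wpDl.
have e''0 : 0 < (e / 2 / (d + 1))%:K.
  by rewrite -(scalar_of_real0 R k) ltr_scalar_of_real.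
move/cvgrPdist_lt : x_x => /(_ _ e''0)[N1 _ xN1].
have e20 : 0 < e / 2 by rewrite divr_gt0.
have [N2 _ xN2] := near_infty_natSinv_lt (PosNum e20).
have := xN1 (maxn N1 N2) (leq_maxl _ _).
have /= := xN2 (maxn N1 N2) (leq_maxr _ _).
set n := maxn _ _ => Hn; rewrite normr_hnorm ltr_scalar_of_real => xn.
rewrite -(subrKA (T (x_ n))); apply: le_trans (ler_hnormD _ _) _.
have := upT x (x_ n); have := Tx_ n.
have : d * hnorm (x - x_ n) <= e / 2.
  have : (d + 1) * hnorm (x - x_ n) <= e / 2.
    by rewrite mulrC -ler_pdivlMr ?ltW// ltr_wpDl.
  by have := hnorm_ge0 (x - x_ n); lra.
move=> dx Tn upTn; rewrite [leRHS]splitr lerD ?(le_trans upTn)//.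
exact/ltW/(le_lt_trans Tn).
Qed.

End HilbertGeometry.

(** * Resolvents and approximate kernels of a bounded accretive operator *)

Section Accretive.
Variables (R : realType) (k : scalar_kind) (H : hilbertSpace R k).
Variable A : {linear H -> H}.
Hypothesis accretive_A : accretive A.
Variable M : R.
Hypotheses (M_gt0 : 0 < M) (le_hnormA : forall x, hnorm (A x) <= M * hnorm x).
Implicit Types (u v w x y f : H) (g r s c d e eta delta : R).
Local Notation "r %:K" := (scalar_of_real k r)
  (at level 1, format "r %:K").

Definition shift g v : H := A v + g%:K *: v.

Lemma linearZK r x : A (r%:K *: x) = r%:K *: A x.
Proof. by rewrite linearZ. Qed.

Lemma scaleKA r s x : r%:K *: (s%:K *: x) = (r * s)%:K *: x.
Proof. by rewrite scalerA scalar_of_realM. Qed.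

Lemma scalerKC r s x : r%:K *: (s%:K *: x) = s%:K *: (r%:K *: x).
Proof. by rewrite !scaleKA mulrC. Qed.

Lemma shiftB g x y : shift g x - shift g y = shift g (x - y).
Proof. by rewrite /shift linearB scalerBr opprD addrACA. Qed.

Lemma accretive_re_inner x : 0 <= re_inner (A x) x.
Proof. exact: accretive_A. Qed.

Lemma re_inner_shift g x : g * hnorm x ^+ 2 <= re_inner (shift g x) x.
Proof.
by rewrite /shift re_innerDl re_innerZl re_inner_hnorm lerDr accretive_re_inner.
Qed.

(** Pair with x and cancel one factor [hnorm x]. Injectivity, closed range and the resolvent bound
    all rest on this estimate. *)
Lemma shift_lower g x : g * hnorm x <= hnorm (shift g x).
Proof.
have [x0|] := eqVneq (hnorm x) 0; first by rewrite x0 mulr0 hnorm_ge0.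
move=> x0; have {}x0 : 0 < hnorm x by rewrite lt_neqAle eq_sym x0 hnorm_ge0.
rewrite -(ler_pM2r x0) -mulrA -expr2.
exact: le_trans (re_inner_shift g x) (re_inner_le _ _).
Qed.

Lemma shift_upper g x : 0 <= g -> hnorm (shift g x) <= (M + g) * hnorm x.
Proof.
move=> g0; apply: le_trans (ler_hnormD _ _) _.
by rewrite hnormZ ger0_norm// mulrDl lerD2r.
Qed.

(* Richardson iteration: moving x by -t times its residual, with
   t = g / (M + g)^2, multiplies the squared residual by 1 - (g / (M + g))^2. *)
Lemma shift_dense_range g f e : 0 < g -> 0 < e ->
  exists x, hnorm (shift g x - f) <= e.
Proof.
move=> g0 e0; set L := M + g; have L0 : 0 < L by rewrite addr_gt0.
pose q := 1 - (g / L) ^+ 2.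
have gL1 : (g / L) ^+ 2 <= 1.
  by rewrite expr_le1 ?divr_ge0 ?ltW// ltr_pdivrMr// mul1r ltrDr.
have gL0 : 0 < (g / L) ^+ 2 by rewrite exprn_gt0 ?divr_gt0.
have iterates n : exists x, hnorm (shift g x - f) ^+ 2 <= q ^+ n * hnorm f ^+ 2.
  elim: n => [|n [x xn]].
    by exists 0; rewrite /shift linear0 scaler0 add0r add0r hnormN expr0 mul1r.
  pose rho := shift g x - f; pose t := g / L ^+ 2.
  exists (x - t%:K *: rho).
  (* By linearity the new residual depends on the old one alone. *)
  have -> : shift g (x - t%:K *: rho) - f = rho - t%:K *: shift g rho.
    rewrite -shiftB /shift linearZK scalerKC -scalerDr.
    by rewrite addrAC.
  rewrite hnorm_subZ_sqr.
  apply: (@le_trans _ _ (q * hnorm rho ^+ 2)); last first.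
    by rewrite (exprS q) -mulrA ler_wpM2l// subr_ge0.
  have t0 : 0 < t by rewrite divr_gt0 ?exprn_gt0.
  have := re_inner_shift g rho; rewrite -(ler_pM2l t0) => H1.
  have H2 : t ^+ 2 * hnorm (shift g rho) ^+ 2 <=
      t ^+ 2 * (L * hnorm rho) ^+ 2.
    rewrite ler_wpM2l ?sqr_ge0// ler_sqr ?nnegrE ?mulr_ge0 ?hnorm_ge0
      ?(ltW L0)//.
    exact/shift_upper/ltW.
  have -> : q * hnorm rho ^+ 2 =
      hnorm rho ^+ 2 - (t * (g * hnorm rho ^+ 2)) *+ 2
        + t ^+ 2 * (L * hnorm rho) ^+ 2.
    by rewrite /q /t; field; rewrite gt_eqF.
  by rewrite lerD// lerB// lerMn2r.
have q1 : `|q| < 1.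
  by rewrite ger0_norm ?subr_ge0// ltrBlDr ltrDl.
have e'0 : 0 < e ^+ 2 / (hnorm f ^+ 2 + 1).
  by rewrite divr_gt0 ?exprn_gt0// ltr_wpDl ?sqr_ge0.
have /cvgrPdist_lt/(_ _ e'0)[N _ /(_ N (leqnn N))/=] := cvg_expr q1.
rewrite sub0r normrN ger0_norm ?exprn_ge0 ?subr_ge0// => qN.
have [x xN] := iterates N; exists x.
rewrite -ler_sqr ?nnegrE ?hnorm_ge0 ?(ltW e0)//; apply: le_trans xN _.
move/ltW: qN; rewrite ler_pdivlMr ?ltr_wpDl ?sqr_ge0// => qN.
apply: le_trans qN.
by rewrite ler_wpM2l ?exprn_ge0 ?subr_ge0// lerDl.
Qed.

(** A range both dense and closed is everything; this is Lax-Milgram for the coercive operator A + g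
    I. *)
Lemma shift_surj g f : 0 < g -> exists x, shift g x = f.
Proof.
move=> g0; apply: (@bilipschitz_closed_range _ _ _ _ g (M + g)) => //.
- by rewrite addr_ge0 ?ltW.
- by move=> x y; rewrite shiftB shift_lower.
- by move=> x y; rewrite shiftB shift_upper ?ltW.
- by move=> e e0; exact: shift_dense_range.
Qed.

(** The partial inverse is a right inverse on the image, which is all of H by surjectivity. *)
Lemma resolventK g f : 0 < g -> shift g (resolvent A g f) = f.
Proof.
move=> g0; have [x xf] := shift_surj f g0.
by apply: (pinvK (fun=> 0)); rewrite inE; exists x.
Qed.

Lemma hnorm_resolvent g f : 0 < g -> hnorm (resolvent A g f) <= hnorm f / g.
Proof.
move=> g0; rewrite ler_pdivlMr// mulrC.
by rewrite -[in leRHS](resolventK f g0) shift_lower.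
Qed.

Lemma shift_inj g : 0 < g -> injective (shift g).
Proof.
move=> g0 x y /eqP; rewrite -subr_eq0 shiftB => /eqP xy0.
apply/eqP; rewrite -subr_eq0; apply/eqP/hnorm_eq0/le_anti.
rewrite hnorm_ge0 andbT -(pmulr_rle0 _ g0).
apply: le_trans (shift_lower g (x - y)) _.
by rewrite xy0 /hnorm normr0 -(scalar_of_real0 R k) scalar_of_realK.
Qed.

Lemma resolventB g f f' : 0 < g ->
  resolvent A g f - resolvent A g f' = resolvent A g (f - f').
Proof. by move=> g0; apply: (shift_inj g0); rewrite -shiftB !resolventK. Qed.

Lemma shift_exact_approx g u : 0 < g ->
  shift g (exact_approx A u g - u) = - (g%:K *: u).
Proof.
by move=> g0; rewrite -shiftB resolventK// /shift opprD addrA subrr add0r.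
Qed.

(* If A were bounded below, then A x = f - g x_g with x_g bounded uniformly in
   g, so that f would be in the closed range of A. *)
Lemma approximate_kernel e : range A <> [set: H] -> 0 < e ->
  exists v, hnorm v = 1 /\ hnorm (A v) <= e.
Proof.
move=> rangeA e0; apply: contrapT => noker; apply: rangeA.
have lowA x : e * hnorm x <= hnorm (A x).
  have [x0|] := eqVneq (hnorm x) 0; first by rewrite x0 mulr0 hnorm_ge0.
  move=> x_neq0.
  have x0 : 0 < hnorm x by rewrite lt_neqAle eq_sym x_neq0 hnorm_ge0.
  rewrite leNgt; apply/negP => Ax; apply: noker; exists ((hnorm x)^-1%:K *: x).
  rewrite linearZK !hnormZ ger0_norm ?invr_ge0 ?hnorm_ge0// mulVf//.
  by split=> //; rewrite mulrC ler_pdivrMr ?ltW.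
rewrite eqEsubset; split=> // f _.
suff [x <-] : exists x, A x = f by exists x.
apply: (@bilipschitz_closed_range _ _ _ _ e M) => //; first exact: ltW.
- by move=> x y; rewrite -linearB.
- by move=> x y; rewrite -linearB.
(* The residual of the x below is -g x, and e |x| <= |A x| <= |f|; this g brings it below d. *)
move=> d d0; pose g := d * e / (hnorm f + 1).
have f10 : 0 < hnorm f + 1 by rewrite ltr_wpDl ?hnorm_ge0.
have g0 : 0 < g by rewrite divr_gt0 ?mulr_gt0.
have [x xf] := shift_surj f g0; exists x.
rewrite -xf /shift opprD addrA subrr add0r hnormN hnormZ gtr0_norm//.
have Ax : hnorm (A x) <= hnorm f.
  (* In the expansion of |A x + g x|^2 the cross terms are nonnegative by accretivity. *)
  rewrite -xf /shift -ler_sqr ?nnegrE ?hnorm_ge0// -[leRHS]re_inner_hnorm.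
  rewrite re_innerDl !re_innerDr !re_innerZl !re_innerZr (re_innerC x (A x)).
  rewrite !re_inner_hnorm -!addrA lerDl.
  have gAx : 0 <= g * re_inner (A x) x.
    by rewrite mulr_ge0 ?(ltW g0)// accretive_re_inner.
  by rewrite !addr_ge0// !(mulr_ge0 (ltW g0))// sqr_ge0.
rewrite /g mulrAC ler_pdivrMr// -mulrA ler_pM2l//.
by rewrite (le_trans (lowA x))// (le_trans Ax)// lerDl.
Qed.

(* Cauchy-Schwarz for the nonnegative form re_inner (A x) y + re_inner (A y) x
   shows that an approximate kernel vector of A is one of its adjoint too. *)
Lemma approximate_cokernel u eta : range A <> [set: H] -> 0 < eta ->
  exists v, [/\ hnorm v = 1, re_inner u v <= 0 &
    forall w, re_inner (A w) v <= eta * hnorm w].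
Proof.
move=> rangeA eta0.
(* Write <A w, v> = B w v - <A v, w> in real parts, with B below. The first bound on e controls the
   last term by eta / 2 |w|; the second gives B w w * B v v <= 4 M e |w|^2 <= (eta / 2 |w|)^2. *)
pose e := Num.min (eta / 2) (eta ^+ 2 / (16 * M)).
have e0 : 0 < e.
  by rewrite lt_min !divr_gt0 ?exprn_gt0 ?mulr_gt0.
have [v [v1 Av]] := approximate_kernel rangeA e0.
have le_e1 : e <= eta / 2 by rewrite ge_min lexx.
have le_e2 : 16 * M * e <= eta ^+ 2.
  by rewrite -ler_pdivlMl ?mulr_gt0// mulrC ge_min lexx orbT.
pose B x y := re_inner (A x) y + re_inner (A y) x.
have CS w : B w v ^+ 2 <= B w w * B v v.
  apply: psd_CauchySchwarz.
  - by move=> x y; rewrite /B addrC.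
  - move=> x y z; rewrite /B linearD re_innerDl re_innerDr; ring.
  - by move=> r x y; rewrite /B linearZK re_innerZl re_innerZr mulrDr.
  - by move=> x; rewrite /B addr_ge0 ?accretive_re_inner.
have bnd w : re_inner (A w) v <= eta * hnorm w.
  have w0 := hnorm_ge0 w.
  have Bw : B w w <= 2 * (M * hnorm w ^+ 2).
    rewrite /B -mulr2n -[leLHS]mulr_natl ler_pM2l//.
    apply: le_trans (re_inner_le _ _) _.
    by rewrite expr2 mulrA ler_wpM2r.
  have Bv : B v v <= 2 * e.
    rewrite /B -mulr2n -[leLHS]mulr_natl ler_pM2l//.
    by apply: le_trans (re_inner_le _ _) _; rewrite v1 mulr1.
  have B0 x : 0 <= B x x by rewrite /B addr_ge0 ?accretive_re_inner.
  have Bwv : B w v <= eta / 2 * hnorm w.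
    have [/ltW Bn|Bp] := ltP (B w v) 0.
      by rewrite (le_trans Bn)// mulr_ge0// divr_ge0// ltW.
    rewrite -ler_sqr ?nnegrE ?mulr_ge0 ?invr_ge0//; last exact: ltW.
    apply: le_trans (CS w) _; apply: le_trans (ler_pM (B0 _) (B0 _) Bw Bv) _.
    have -> : 2 * (M * hnorm w ^+ 2) * (2 * e) =
      (16 * M * e) * (hnorm w ^+ 2 / 4) by field.
    have -> : (eta / 2 * hnorm w) ^+ 2 = eta ^+ 2 * (hnorm w ^+ 2 / 4) by field.
    by rewrite ler_wpM2r// divr_ge0// sqr_ge0.
  have : - re_inner (A v) w <= eta / 2 * hnorm w.
    rewrite -re_innerNl; apply: le_trans (re_inner_le _ _) _.
    by rewrite hnormN ler_wpM2r// (le_trans Av).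
  by move: Bwv; rewrite /B; lra.
(* Replacing v by -v fixes the sign and keeps the bound, since w ranges over all vectors. *)
have [uv|/ltW uv] := leP (re_inner u v) 0; first by exists v.
exists (- v); split; first by rewrite hnormN.
  by rewrite re_innerNr oppr_le0.
by move=> w; rewrite re_innerNr -re_innerNl -linearN -(hnormN w) bnd.
Qed.

(** * Comparison of the best error with the best bound *)

Lemma hnorm_exact_approx_sub g u :
  0 < g -> hnorm (exact_approx A u g - u) <= hnorm u.
Proof.
(* The bias is mapped to -g u by A + g I, so the factor g cancels the loss 1 / g of the
   resolvent. *)
move=> g0; rewrite -(ler_pM2l g0); apply: le_trans (shift_lower g _) _.
by rewrite shift_exact_approx// hnormN hnormZ gtr0_norm.
Qed.

Lemma best_error_le_best_bound delta u :
  (best_error A delta u <= best_bound A delta u)%E.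
Proof.
apply/ereal_supP => _ [f /= fdelta <-]; apply/ereal_infP => _ [g /= g0 <-].
apply: le_trans (_ : (hnorm (resolvent A g f - u))%:E <= _)%E.
  by apply: ereal_inf_lbound; exists g.
rewrite lee_fin -(subrKA (exact_approx A u g)) addrC.
apply: le_trans (ler_hnormD _ _) _; rewrite lerD2l.
rewrite resolventB//; apply: le_trans (hnorm_resolvent _ g0) _.
by rewrite ler_pM2r ?invr_gt0// hnorm_subC.
Qed.

Lemma best_bound_le_best_error delta u : range A <> [set: H] -> 0 < delta ->
  (best_bound A delta u <= 5%:E * best_error A delta u)%E.
Proof.
move=> rangeA delta0.
have ud0 : 0 < hnorm u + delta by rewrite ltr_wpDl ?hnorm_ge0.
(* Chosen so that delta <= 2 eta |z| reads |u| + delta <= |z|. *)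
pose eta := delta / (2 * (hnorm u + delta)).
have eta0 : 0 < eta by rewrite divr_gt0 ?mulr_gt0.
have [v [v1 uv Av]] := approximate_cokernel u rangeA eta0.
pose f := A u + delta%:K *: v.
have fdelta : f - A u = delta%:K *: v by rewrite /f addrC addKr.
have hdelta : hnorm (delta%:K *: v) = delta.
  by rewrite hnormZ v1 mulr1 gtr0_norm.
rewrite -lee_pdivrMl//.
(* The supremum is bounded below through this single f, fixed before g. *)
apply: le_trans (ereal_sup_ubound _); last first.
  by exists f => //=; rewrite hnorm_subC fdelta hdelta.
apply/ereal_infP => _ [g /= g0 <-]; rewrite lee_pdivrMl// -EFinM.
set z := resolvent A g f - u.
have z_lower : delta <= (g + eta) * hnorm z.
  have shift_z : shift g z = delta%:K *: v - g%:K *: u.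
    by rewrite -shiftB resolventK// /shift opprD addrA fdelta.
  have : re_inner (shift g z) v = delta - g * re_inner u v.
    rewrite shift_z re_innerDl re_innerNl !re_innerZl re_inner_hnorm v1.
    by rewrite expr1n mulr1.
  rewrite /shift re_innerDl re_innerZl => zv.
  have zv1 : g * re_inner z v <= g * hnorm z.
    by rewrite ler_pM2l// (le_trans (re_inner_le _ _))// v1 mulr1.
  have guv : g * re_inner u v <= 0 by rewrite pmulr_rle0.
  have := Av z; lra.
have z0 := hnorm_ge0 z.
have [etag|geta] := leP eta g.
  (* The factor 5 arises here: the bias is at most |z| + delta / g, and delta / g <= 2 |z|. *)
  apply: le_trans (_ : (hnorm (exact_approx A u g - u) + delta / g)%:E <= _)%E.
    by apply: ereal_inf_lbound; exists g.
  have dg : delta / g <= 2 * hnorm z.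
    rewrite ler_pdivrMr// (le_trans z_lower)//.
    have : (g + eta) * hnorm z <= (g + g) * hnorm z.
      by rewrite ler_wpM2r// lerD2l.
    lra.
  have : hnorm (exact_approx A u g - u) <= hnorm z + delta / g.
    have -> : exact_approx A u g - u =
        z - (resolvent A g f - exact_approx A u g).
      by rewrite /z opprB [RHS]addrC subrKA.
    apply: le_trans (ler_hnormD _ _) _; rewrite lerD2l hnormN resolventB//.
    by rewrite fdelta (le_trans (hnorm_resolvent _ g0))// hdelta.
  by rewrite lee_fin; lra.
(* The parameter 1 bounds the infimum by |u| + delta, whatever the small g is. *)
apply: le_trans (_ : (hnorm (exact_approx A u 1 - u) + delta / 1)%:E <= _)%E.
  by apply: ereal_inf_lbound; exists 1 => //=.
have := hnorm_exact_approx_sub u ltr01.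
have : hnorm u + delta <= hnorm z.
  have : delta <= 2 * eta * hnorm z.
    rewrite (le_trans z_lower)// ler_wpM2r//; lra.
  have -> : 2 * eta * hnorm z = delta * hnorm z / (hnorm u + delta).
    by rewrite /eta; field; rewrite gt_eqF.
  by rewrite ler_pdivlMr// ler_pM2l.
by rewrite lee_fin divr1; lra.
Qed.

End Accretive.

(** The constant of [linear_boundedP] lies in [scalars R k]; being positive, it is real. *)
Lemma bounded_near0_hnorm (R : realType) (k : scalar_kind)
    (H : hilbertSpace R k) (A : {linear H -> H}) :
  bounded_near A (nbhs (0 : H)) ->
  exists2 M : R, 0 < M & forall x, hnorm (A x) <= M * hnorm x.
Proof.
move=> /linear_boundedP/pinfty_ex_gt0[M M0 AM].
exists (scalar_re M).
  by rewrite -(ltr_scalar_of_real k) scalar_of_real0 scalar_reK// ltW.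
move=> x; rewrite -(ler_scalar_of_real k) scalar_of_realM.
rewrite scalar_reK ?(ltW M0)//.
by rewrite -!normr_hnorm.
Qed.

Theorem corollary3p9 (R : realType) (k : scalar_kind) (H : hilbertSpace R k)
    (A : {linear H -> H})
    (bounded_A : bounded_near A (nbhs (0 : H)))
    (accretive_A : accretive A)
    (range_A : range A <> [set: H])
    (gam : R -> H -> \bar R)
    (choice_gam : parameter_choice gam) :
  weakly_quasi_optimal A gam <-> strongly_quasi_optimal A gam.
Proof.
have [M M0 AM] := bounded_near0_hnorm bounded_A.
split=> -[c [c0 opt]].
- exists (c * 5); split; first by rewrite mulr_gt0.
  move=> u delta f delta0 fdelta; apply: le_trans (opt _ _ _ delta0 fdelta) _.
  rewrite EFinM -muleA lee_pmul2l//.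
  exact: (best_bound_le_best_error accretive_A M0 AM).
- exists c; split=> // u delta f delta0 fdelta.
  apply: le_trans (opt _ _ _ delta0 fdelta) _.
  rewrite lee_pmul2l//.
  exact: (best_error_le_best_bound accretive_A M0 AM).
Qed.
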